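(* Let $\Sigma$ be a set and let $(X,\lambda)$, $(Y,\mu)$ be labeled HDA over $\Sigma$. Then they are homotopy bisimilar (as labeled HDA) if and only if they are hd-bisimilar (as labeled HDA).
   Context: A precubical set $X$ is a family of pairwise disjoint sets $(X_n)_{n\ge0}$ with face maps $\delta_k^\nu:X_n\to X_{n-1}$ ($n\ge1$, $1\le k\le n$, $\nu\in\{0,1\}$) satisfying $\delta_k^\nu\delta_\ell^\mu=\delta_{\ell-1}^\mu\delta_k^\nu$ for $k<\ell$; morphisms are families of maps $X_n\to Y_n$ commuting with face maps. An HDA is a precubical set with a distinguished $0$-cube $i$; $\mathsf{HDA}$ is the category of HDA and point-preserving morphisms. Cube paths, homotopy: a cube path is a sequence $(x_1,\dots,x_m)$ with, for each $j<m$, $x_j=\delta_k^0x_{j+1}$ or $x_{j+1}=\delta_k^1x_j$ for some $k$; pointed if $x_1=i$. Two cube paths $(x_1,\dots,x_m)$, $(y_1,\dots,y_m)$ are adjacent if $x_1=y_1$, $x_m=y_m$, exactly one index $p$ has $x_p\ne y_p$, and for some $k<\ell$ one of the following holds, or holds with the paths interchanged: (i) $x_{p-1}=\delta_k^0x_p$, $x_p=\delta_\ell^0x_{p+1}$, $y_{p-1}=\delta_{\ell-1}^0y_p$, $y_p=\delta_k^0y_{p+1}$; (ii) $x_p=\delta_k^1x_{p-1}$, $x_{p+1}=\delta_\ell^1x_p$, $y_p=\delta_{\ell-1}^1y_{p-1}$, $y_{p+1}=\delta_k^1y_p$; (iii) $x_p=\delta_k^0\delta_\ell^1y_p$, $y_{p-1}=\delta_k^0y_p$,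 $y_{p+1}=\delta_\ell^1y_p$; (iv) $x_p=\delta_k^1\delta_\ell^0y_p$, $y_{p-1}=\delta_\ell^0y_p$, $y_{p+1}=\delta_k^1y_p$. Homotopy $\sim$ is the reflexive transitive closure of adjacency. Unfolding of an HDA $(X,i)$: $\tilde X_n$ = homotopy classes $[x_1,\dots,x_m]$ of pointed cube paths with $x_m\in X_n$, point $[i]$, $\tilde\delta_k^1[x_1,\dots,x_m]=[x_1,\dots,x_m,\delta_k^1x_m]$, $\tilde\delta_k^0[x_1,\dots,x_m]=\{(y_1,\dots,y_p)\mid y_p=\delta_k^0x_m,(y_1,\dots,y_p,x_m)\sim(x_1,\dots,x_m)\}$; $\pi_X[x_1,\dots,x_m]=x_m$ is a pointed morphism $\tilde X\to X$, an isomorphism when every cube of $X$ has exactly one homotopy class of pointed cube paths to it. A pointed precubical morphism $g:X\to Y$ induces $\tilde g:\tilde X\to\tilde Y$, $\tilde g[x_1,\dots,x_m]=[gx_1,\dots,gx_m]$. Paths and open maps: a precubical path object is a precubical set $P$ with a (unique) cube path $(p_1,\dots,p_m)$ of distinct elements such that every element is $\delta_{k_1}^{\nu_1}\cdots\delta_{k_s}^{\nu_s}p_j$ for some $j$ and a unique $k_1<\dots<k_s$; pointed at $p_1$. $\mathsf{HDP}$ is the subcategory of $\mathsf{HDA}$ on pointed path objects with morphisms generated by isomorphisms and cube path extensions ($g(p_j)=q_j$ for $j\le m$). A morphism $f:X\to Y$ of $\mathsf{HDA}$ is open if for all $g:P\to Q$ in $\mathsf{HDP}$ and $p:P\to X$,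 $q:Q\to Y$ in $\mathsf{HDA}$ with $f p=q g$ there is $r:Q\to X$ with $rg=p$, $fr=q$. $\mathsf{HDA}_h$: objects HDA, morphisms $X\to Y$ are pointed precubical morphisms $\tilde X\to\tilde Y$. $\mathsf{HDP}_h\subseteq\mathsf{HDA}_h$: objects of $\mathsf{HDP}$, morphisms $\pi_Q^{-1}\circ g\circ\pi_P$ for $g$ in $\mathsf{HDP}$. A morphism of $\mathsf{HDA}_h$ is open if it has the analogous right lifting property in $\mathsf{HDA}_h$ against all morphisms of $\mathsf{HDP}_h$. Labels: for a finite or countably infinite set $S=\{a_1,a_2,\dots\}$, the precubical set $!S$ has $!S_n=\{(a_{i_1},\dots,a_{i_n})\mid i_1\le\dots\le i_n\}$ and $\delta_k^\nu(a_{i_1},\dots,a_{i_n})=(a_{i_1},\dots,a_{i_{k-1}},a_{i_{k+1}},\dots,a_{i_n})$ for both $\nu$; it has a single $0$-cube, its point. A labeled HDA over $\Sigma$ is an HDA $X$ with a precubical morphism $\lambda:X\to\,!\Sigma$. A morphism $(X,\lambda)\to(Y,\mu)$ of labeled HDA is a pointed morphism $f:X\to Y$ with $\mu\circ f=\lambda$; it is open if $f$ is open in $\mathsf{HDA}$. Labeled HDA are hd-bisimilar if there are a labeled HDA $(Z,\zeta)$ over $\Sigma$ and open labeled morphisms $Z\to X$, $Z\to Y$. A morphism $(X,\lambda)\to(Y,\mu)$ up to homotopy is a pointed precubical morphism $f:\tilde X\to\tilde Y$ with $\tilde\mu\circ f=\tilde\lambda$; it is open if $f$ is open in $\mathsf{HDA}_h$.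 Labeled HDA are homotopy bisimilar if there are a labeled HDA $(Z,\zeta)$ over $\Sigma$ and open morphisms up to homotopy $Z\to X$, $Z\to Y$.
   Formalization: Clause (ii) of adjacency is corrected to x_{p+1}=δ_{ℓ-1}^1 x_p, y_p=δ_ℓ^1 y_{p-1}; lower faces in unfoldings may contain several classes, and morphisms preserve this relation; path objects need exactly one homotopy class per cube and unique faces for every p_j. *)

(* Defs.v *)
(* Mathematical Components with classical logic from mathcomp-classical. *)
From HB Require Import structures.
From Stdlib Require Export Relation_Operators.
From mathcomp Require Export all_boot boolp classical_sets.
From mathcomp Require Import zify.

Set Implicit Arguments.
Unset Strict Implicit.
Unset Printing Implicit Defensive.

Local Open Scope quotient_scope.
Local Open Scope classical_set_scope.

(** * Precubical sets and higher-dimensional automata *)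

(* Directions are numbered from 0, and [false], [true] stand for the lower (0)
   and upper (1) faces.  [faceC] is the precubical identity
   [d_k d_l = d_(l-1) d_k] for [k < l], written with [l - 1] as [l]. *)
Record precubical := Precubical {
  cell :> nat -> Type;
  face : forall n, 'I_n.+1 -> bool -> cell n.+1 -> cell n;
  faceC : forall n (k l : 'I_n.+1) (nu mu : bool) (x : cell n.+2), k <= l ->
    face k nu (face (lift ord0 l) mu x)
    = face l mu (face (widen_ord (leqnSn n.+1) k) nu x) }.

Record pmor (X Y : precubical) := Pmor {
  pmap :> forall n, X n -> Y n;
  pmap_face : forall n (k : 'I_n.+1) nu (x : X n.+1),
    pmap (face k nu x) = face k nu (pmap x) }.

Record hda := Hda { carrier :> precubical; point : carrier 0 }.

Record hmor (X Y : hda) := Hmor {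
  hmap :> pmor X Y;
  hmap_point : hmap 0 (point X) = point Y }.

Lemma hmor_comp_face (X Y Z : hda) (g : hmor Y Z) (f : hmor X Y) n
    (k : 'I_n.+1) nu (x : X n.+1) :
  g n (f n (face k nu x)) = face k nu (g n.+1 (f n.+1 x)).
Proof. by rewrite !pmap_face. Qed.

Lemma hmor_comp_point (X Y Z : hda) (g : hmor Y Z) (f : hmor X Y) :
  g 0 (f 0 (point X)) = point Z.
Proof. by rewrite !hmap_point. Qed.

Definition hcomp (X Y Z : hda) (g : hmor Y Z) (f : hmor X Y) : hmor X Z :=
  @Hmor X Z (@Pmor X Z (fun n x => g n (f n x)) (hmor_comp_face g f))
    (hmor_comp_point g f).

Definition hiso (X Y : hda) (g : hmor X Y) : Prop :=
  exists g' : hmor Y X, forall n, cancel (g n) (g' n) /\ cancel (g' n) (g n).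

(** * Cube paths and homotopy *)

Definition cube (X : precubical) : Type := {n : nat & X n}.
Definition Cube (X : precubical) n (x : X n) : cube X := existT _ n x.

Definition cube_map (X Y : precubical) (f : pmor X Y) (c : cube X) : cube Y :=
  Cube (f _ (projT2 c)).

(* [is_face nu k y x]: the cube [y] is the face [d_k^nu x]. *)
Inductive is_face (X : precubical) (nu : bool) : nat -> cube X -> cube X -> Prop :=
  IsFace n (k : 'I_n.+1) (x : X n.+1) : is_face nu k (Cube (face k nu x)) (Cube x).

Definition step (X : precubical) (x y : cube X) : Prop :=
  exists k, is_face false k x y \/ is_face true k y x.

Definition cube_path (X : precubical) (s : seq (cube X)) : bool :=
  if s is x :: s' then path (fun x y => `[< step x y >]) x s' else false.

(* The two paths are [.., a, x, b, ..] and [.., a, y, b, ..].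
   In the second clause the two routes from [a] to [b] are paired by
   [d_(l-1)^1 d_k^1 = d_k^1 d_l^1]. *)
Definition homotopy_square (X : precubical) (a x y b : cube X) : Prop :=
  exists k l : nat, k < l /\
  [\/ [/\ is_face false k a x, is_face false l x b,
          is_face false l.-1 a y & is_face false k y b],
      [/\ is_face true k x a, is_face true l.-1 b x,
          is_face true l y a & is_face true k b y],
      [/\ exists2 z, is_face false k x z & is_face true l z y,
          is_face false k a y & is_face true l b y]
    | [/\ exists2 z, is_face true k x z & is_face false l z y,
          is_face false l a y & is_face true k b y]].

Definition adjacent (X : precubical) (s t : seq (cube X)) : Prop :=
  exists u a x y b v,
    [/\ s = u ++ [:: a, x, b & v], t = u ++ [:: a, y, b & v], x <> y
      & homotopy_square a x y b \/ homotopy_square a y x b].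

Definition homotopic (X : precubical) : seq (cube X) -> seq (cube X) -> Prop :=
  clos_refl_trans _ (fun s t => [/\ cube_path s, cube_path t & adjacent s t]).

Lemma homotopic_sym (X : precubical) (s t : seq (cube X)) :
  homotopic s t -> homotopic t s.
Proof.
elim=> [s1 t1 [ps pt [u [a [x [y [b [v [es et nxy sq]]]]]]]]|s1|s1 s2 s3 _ h1 _ h2].
- apply: rt_step; split=> //.
  by exists u, a, y, x, b, v; split=> //; [move=> e; apply: nxy | case: sq; auto].
- exact: rt_refl.
- exact: rt_trans h2 h1.
Qed.

(** * The unfolding *)

Definition pointed_path (X : hda) (s : seq (cube X)) : Prop :=
  cube_path s /\ ohead s = Some (Cube (point X)).

(* Pointed cube paths [(x_1, .., x_m)] with [x_m] in [X n]: [x_m] is [ppend]. *)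
Record ppath (X : hda) n := PPath {
  ppinit : seq (cube X);
  ppend : X n;
  ppathP : pointed_path (rcons ppinit (Cube ppend)) }.

Definition ppseq (X : hda) n (p : ppath X n) : seq (cube X) :=
  rcons (ppinit p) (Cube (ppend p)).

Definition pphomotopic (X : hda) n : rel {classic ppath X n} :=
  fun p q => `[< homotopic (ppseq p) (ppseq q) >].

Lemma pphomotopic_refl (X : hda) n : reflexive (@pphomotopic X n).
Proof. by move=> p; apply/asboolP; apply: rt_refl. Qed.

Lemma pphomotopic_sym (X : hda) n : symmetric (@pphomotopic X n).
Proof. by move=> p q; apply/asboolP/asboolP; apply: homotopic_sym. Qed.

Lemma pphomotopic_trans (X : hda) n : transitive (@pphomotopic X n).
Proof.
by move=> q p r /asboolP pq /asboolP qr; apply/asboolP; apply: rt_trans pq qr.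
Qed.

Canonical pphomotopic_equiv (X : hda) n :=
  EquivRel (@pphomotopic X n) (@pphomotopic_refl X n)
    (@pphomotopic_sym X n) (@pphomotopic_trans X n).

(* The [n]-cubes of the unfolding of [X]. *)
Definition unf (X : hda) n := {eq_quot (pphomotopic_equiv X n)}.

Definition hclass (X : hda) n (p : ppath X n) : unf X n :=
  \pi_(unf X n) (p : {classic ppath X n}).
Definition hrepr (X : hda) n (c : unf X n) : ppath X n := repr c.

Lemma nil_ppathP (X : hda) : pointed_path (rcons [::] (Cube (point X))).
Proof. by []. Qed.

Definition unf_point (X : hda) : unf X 0 := hclass (PPath (nil_ppathP X)).

Definition unf_pi (X : hda) n (c : unf X n) : X n := ppend (hrepr c).

Lemma upface_ppathP (X : hda) n (k : 'I_n.+1) (p : ppath X n.+1) :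
  pointed_path (rcons (ppseq p) (Cube (face k true (ppend p)))).
Proof.
case: p => -[|c s] x [] /=; rewrite /ppseq /pointed_path /= ?andbT.
- move=> _ ->; split=> //.
  by apply/asboolP; exists k; right; exact: IsFace.
- move=> ps ->; rewrite rcons_path ps last_rcons; split=> //.
  by apply/asboolP; exists k; right; apply: IsFace.
Qed.

Definition unf_upper (X : hda) n (k : 'I_n.+1) (c : unf X n.+1) : unf X n :=
  hclass (PPath (upface_ppathP k (hrepr c))).

(* The lower face of a class is a set of pointed cube paths.  It is closed under
   homotopy, and is normally a single class, but not always: if a square [x] with
   distinct lower edges [a], [b] out of the point [v] has both upper faces equal
   to [f], then the lower face of [[v, a, x, f]] contains [(v, a, w)] and
   [(v, b, w)], with [w] the lower face of [f], which need not be homotopic. *)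
Definition unf_lower (X : hda) n (k : 'I_n.+1) (c : unf X n.+1) : set (ppath X n) :=
  [set y | ppend y = face k false (unf_pi c) /\
           homotopic (rcons (ppseq y) (Cube (unf_pi c))) (ppseq (hrepr c))].

(* A homotopy class as a set of pointed cube paths. *)
Definition class_set (X : hda) n (c : unf X n) : set (ppath X n) :=
  [set p | hclass p = c].

(* Pointed precubical morphisms between unfoldings.  Where lower faces are
   single classes, [umap_lower] says that [f] commutes with the lower faces:
   see [umap_lower_class]. *)
Record unf_mor (X Y : hda) := UnfMor {
  umap :> forall n, unf X n -> unf Y n;
  umap_point : umap (unf_point X) = unf_point Y;
  umap_upper : forall n (k : 'I_n.+1) (c : unf X n.+1),
    umap (unf_upper k c) = unf_upper k (umap c);
  umap_lower : forall n (k : 'I_n.+1) (c : unf X n.+1) (d : unf X n),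
    class_set d `<=` unf_lower k c ->
    class_set (umap d) `<=` unf_lower k (umap c) }.

Lemma hreprK (X : hda) n (c : unf X n) : hclass (hrepr c) = c.
Proof. exact: reprK. Qed.

Lemma umap_lower_class (X Y : hda) (f : unf_mor X Y) n (k : 'I_n.+1)
    (c : unf X n.+1) (d : unf X n) (e : unf Y n) :
  unf_lower k c = class_set d -> unf_lower k (f _ c) = class_set e -> f _ d = e.
Proof.
move=> hd he; have: class_set (f _ d) `<=` class_set e.
  by rewrite -he; apply: umap_lower; rewrite hd.
by move=> /(_ (hrepr (f _ d)) (hreprK _)) /=; rewrite /class_set /= hreprK.
Qed.

Lemma step_map (X Y : precubical) (f : pmor X Y) (x y : cube X) :
  step x y -> step (cube_map f x) (cube_map f y).
Proof.
case=> k [[n l z]|[n l z]]; exists l; rewrite /cube_map /= pmap_face;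
  [left | right]; exact: IsFace.
Qed.

Lemma ppath_mapP (X Y : hda) (g : hmor X Y) n (p : ppath X n) :
  pointed_path (rcons (map (cube_map g) (ppinit p)) (Cube (g n (ppend p)))).
Proof.
case: p => s x [/=].
rewrite -[Cube (g n x)]/(cube_map g (Cube x)) -map_rcons.
case: (rcons s _) => [//|c t] pt /= [ec]; split; last first.
  by rewrite /= ec /cube_map /= hmap_point.
elim: t c pt {ec} => [//|d t IH] c /= /andP[/asboolP sd pt].
by apply/andP; split; [apply/asboolP; apply: step_map | apply: IH].
Qed.

Definition ppath_map (X Y : hda) (g : hmor X Y) n (p : ppath X n) : ppath Y n :=
  PPath (ppath_mapP g p).

(* The map of unfoldings induced by [g]. *)
Definition unf_map (X Y : hda) (g : hmor X Y) n (c : unf X n) : unf Y n :=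
  hclass (ppath_map g (hrepr c)).

(** * Path objects and open maps *)

(* [iter_face [:: (k1, nu1); ..; (ks, nus)] y x]:
   [y = d_k1^nu1 (.. (d_ks^nus x))]. *)
Fixpoint iter_face (X : precubical) (w : seq (nat * bool)) (y x : cube X) : Prop :=
  if w is (k, nu) :: w' then exists2 z, is_face nu k y z & iter_face w' z x
  else y = x.

Definition increasing (w : seq (nat * bool)) : bool := sorted ltn (unzip1 w).

(* The path is part of the data: for instance an edge [e] with end points [v], [w]
   carries both paths [(v, e)] and [(v, e, w)].  [po_tree] makes the projection
   [unf_pi] of a path object bijective, and excludes cyclic gluings. *)
Record path_object := PathObject {
  po_hda :> hda;
  po_path : seq (cube po_hda);
  po_pointed : pointed_path po_path;
  po_distinct : uniq (po_path : seq {classic cube po_hda});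
  po_cover : forall c : cube po_hda,
    exists2 p, (p : {classic cube po_hda}) \in (po_path : seq {classic cube po_hda})
    & exists2 w, increasing w & iter_face w c p;
  po_unique : forall (c p : cube po_hda) w w',
    (p : {classic cube po_hda}) \in (po_path : seq {classic cube po_hda}) ->
    increasing w -> increasing w' ->
    iter_face w c p -> iter_face w' c p -> w = w';
  po_tree : forall n (c : po_hda n), exists! u : unf po_hda n, unf_pi u = c }.

Definition path_extension (P Q : path_object) (g : hmor P Q) : Prop :=
  exists s, po_path Q = map (cube_map g) (po_path P) ++ s.

(* The morphisms of HDP. *)
Inductive hdp : forall P Q : path_object, hmor P Q -> Prop :=
| hdp_iso (P Q : path_object) (g : hmor P Q) : hiso g -> hdp g
| hdp_ext (P Q : path_object) (g : hmor P Q) : path_extension g -> hdp g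
| hdp_comp (P Q R : path_object) (g : hmor Q R) (f : hmor P Q) :
    hdp g -> hdp f -> @hdp P R (hcomp g f).

Definition hda_open (X Y : hda) (f : hmor X Y) : Prop :=
  forall (P Q : path_object) (g : hmor P Q) (p : hmor P X) (q : hmor Q Y),
    hdp g ->
    (forall n (c : P n), f n (p n c) = q n (g n c)) ->
    exists r : hmor Q X,
      (forall n (c : P n), r n (g n c) = p n c) /\
      (forall n (c : Q n), f n (r n c) = q n c).

(* The morphisms of HDP_h: [h = pi_Q^-1 o g o pi_P], where [pi_Q] is bijective. *)
Definition hdp_h (P Q : path_object) (h : unf_mor P Q) : Prop :=
  exists2 g : hmor P Q, hdp g
  & forall n (c : unf P n), unf_pi (h n c) = g n (unf_pi c).

Definition hdah_open (X Y : hda) (f : unf_mor X Y) : Prop :=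
  forall (P Q : path_object) (h : unf_mor P Q) (p : unf_mor P X) (q : unf_mor Q Y),
    hdp_h h ->
    (forall n (c : unf P n), f n (p n c) = q n (h n c)) ->
    exists r : unf_mor Q X,
      (forall n (c : unf P n), r n (h n c) = p n c) /\
      (forall n (c : unf Q n), f n (r n c) = q n c).

(** * Labels *)

(* The alphabet is at most countable and enumerated by [pickle]. *)
Definition pickle_le (S : countType) : rel S := fun a b => pickle a <= pickle b.

Definition bang_cell (S : countType) n : Type :=
  {t : n.-tuple S | sorted (@pickle_le S) t}.

Definition tuple_del (S : Type) n (k : 'I_n.+1) (t : n.+1.-tuple S) : n.-tuple S :=
  [tuple tnth t (lift k j) | j < n].

Lemma tuple_del_sorted (S : countType) n (k : 'I_n.+1) (t : n.+1.-tuple S) :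
  sorted (@pickle_le S) t -> sorted (@pickle_le S) (tuple_del k t).
Proof.
move=> st; case: n k t st => [k t _|n k t st].
  by case: (tuple_del k t) => -[|].
have tr : transitive (@pickle_le S) by move=> b a c; apply: leq_trans.
have x0 : S := tnth t ord0.
rewrite sorted_pairwise //; apply/(pairwiseP x0) => i j.
rewrite !inE !size_tuple => hi hj ij.
rewrite -[i]/(val (Ordinal hi)) -[j]/(val (Ordinal hj)) -!tnth_nth !tnth_mktuple.
rewrite !(tnth_nth x0); move: st; rewrite sorted_pairwise // => /(pairwiseP x0).
apply; rewrite ?inE ?size_tuple; try exact: (ltn_ord (lift k _)).
by rewrite /= /bump; lia.
Qed.

Definition bang_face (S : countType) n (k : 'I_n.+1) (nu : bool)
    (t : bang_cell S n.+1) : bang_cell S n :=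
  exist _ (tuple_del k (val t)) (tuple_del_sorted k (valP t)).

Lemma bang_faceC (S : countType) n (k l : 'I_n.+1) (nu mu : bool)
    (t : bang_cell S n.+2) : k <= l ->
  bang_face k nu (bang_face (lift ord0 l) mu t)
  = bang_face l mu (bang_face (widen_ord (leqnSn n.+1) k) nu t).
Proof.
move=> kl; apply: val_inj; apply: eq_from_tnth => j /=.
rewrite !tnth_mktuple; congr tnth; apply: val_inj => /=; rewrite /bump.
lia.
Qed.

Definition bang (S : countType) : precubical := Precubical (@bang_faceC S).

Definition bang_hda (S : countType) : hda :=
  @Hda (bang S) (exist _ [tuple] isT).

Record lhda (S : countType) := LHda {
  lcarrier :> hda;
  lab : pmor lcarrier (bang S) }.

Lemma lab_point (S : countType) (X : lhda S) :
  lab X 0 (point X) = point (bang_hda S).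
Proof. by apply: val_inj; apply: tuple0. Qed.

Definition hlab (S : countType) (X : lhda S) : hmor X (bang_hda S) :=
  @Hmor X (bang_hda S) (lab X) (lab_point X).

Definition lab_mor (S : countType) (X Y : lhda S) (f : hmor X Y) : Prop :=
  forall n (x : X n), lab Y n (f n x) = lab X n x.

Definition hd_bisimilar (S : countType) (X Y : lhda S) : Prop :=
  exists (Z : lhda S) (f : hmor Z X) (g : hmor Z Y),
    [/\ lab_mor f, hda_open f, lab_mor g & hda_open g].

Definition lab_unf_mor (S : countType) (X Y : lhda S) (f : unf_mor X Y) : Prop :=
  forall n (c : unf X n), unf_map (hlab Y) (f n c) = unf_map (hlab X) c.

Definition homotopy_bisimilar (S : countType) (X Y : lhda S) : Prop :=
  exists (Z : lhda S) (f : unf_mor Z X) (g : unf_mor Z Y),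
    [/\ lab_unf_mor f, hdah_open f, lab_unf_mor g & hdah_open g].

(* Main.v *)
(** A morphism [f] of unfoldings is determined by the end cubes of its values, and
    a path object is isomorphic to its unfolding, so that morphisms out of a path
    object are the same in both categories.  Hence open maps induce open maps of
    unfoldings, and hd-bisimilar automata are homotopy bisimilar.

    Conversely a span [X~ <- Z~ -> Y~] should be read as a span of automata with
    apex [Z~].  As lower faces in [Z~] are not single-valued, [Z~] is replaced by
    the cofree precubical set [W] on it: an [n]-cube of [W] is an [n]-cube of
    [Z~] with a coherent choice of all its iterated faces.  Morphisms from a path
    object [P] to [W] are morphisms from [P~] to [Z~], which turns lifting
    problems for [W -> X] into lifting problems for [Z~ -> X~]. *)

Require Import Defs.
From mathcomp Require Import zify.

Set Implicit Arguments.
Unset Strict Implicit.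
Unset Printing Implicit Defensive.

Local Open Scope quotient_scope.
Local Open Scope classical_set_scope.

(** * Faces and homotopies *)

Lemma Cube_inj (X : precubical) n : injective (@Cube X n).
Proof. by move=> x y; exact: eq_from_Tagged. Qed.

Lemma is_faceE (X : precubical) nu k (y x : cube X) :
  is_face nu k y x <-> exists n (i : 'I_n.+1) (z : X n.+1),
    [/\ k = i, x = Cube z & y = Cube (face i nu z)].
Proof.
by split=> [[n i z]|[n [i [z [-> -> ->]]]]]; [exists n, i, z | exact: IsFace].
Qed.

Lemma is_face_Cube (X : precubical) nu k n (y : cube X) (x : X n.+1) :
  is_face nu k y (Cube x) ->
  exists2 i : 'I_n.+1, k = i & y = Cube (face i nu x).
Proof.
move=> /is_faceE[m [i [z [-> e ->]]]].
have em : n = m by move: (congr1 (@projT1 _ _) e) => -[].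
by subst m; move/Cube_inj: e => ->; exists i.
Qed.

Lemma is_face_dim (X : precubical) nu k (y x : cube X) :
  is_face nu k y x -> projT1 x = (projT1 y).+1 /\ k < projT1 x.
Proof. by case. Qed.

Lemma is_face_exists (X : precubical) nu k (x : cube X) :
  k < projT1 x -> exists y, is_face nu k y x.
Proof.
case: x => [[//|n] x] /= kn.
by exists (Cube (face (Ordinal kn) nu x)); exact: (IsFace nu (Ordinal kn) x).
Qed.

Lemma is_face_fun (X : precubical) nu k (y y' x : cube X) :
  is_face nu k y x -> is_face nu k y' x -> y = y'.
Proof.
case=> n i z /is_face_Cube[j ij ->].
by have -> : i = j by exact: val_inj.
Qed.

(** [faceC] read from left to right, as a relation between cubes of any dimension with numerical
    indices. It completes a chain of two faces to a square; [is_face_swapS] reads the identity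
    backwards. *)
Lemma is_face_swap (X : precubical) nu mu k l (e b c : cube X) : k < l ->
  is_face nu k e b -> is_face mu l b c ->
  exists a, is_face mu l.-1 e a /\ is_face nu k a c.
Proof.
move=> kl eb bc; case: bc eb kl => -[|n] j z eb kl.
  by case/is_face_dim: eb.
move: eb => /is_face_Cube[i ki ->]; subst k.
have jn : j.-1 < n.+1 by case: j kl => /= j; lia.
pose l' := Ordinal jn; have jE : j = lift ord0 l'.
  by apply: val_inj; rewrite /= /bump /=; lia.
exists (Cube (face (widen_ord (leqnSn n.+1) i) nu z)).
rewrite jE faceC; last by rewrite /=; lia.
split; last exact: (IsFace nu (widen_ord (leqnSn n.+1) i) z).
exact: (IsFace mu l').
Qed.

Lemma is_face_swapS (X : precubical) nu mu k l (e b c : cube X) : k <= l ->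
  is_face mu l e b -> is_face nu k b c ->
  exists a, is_face nu k e a /\ is_face mu l.+1 a c.
Proof.
move=> kl eb bc; case: bc eb kl => -[|n] i z eb kl.
  by case/is_face_dim: eb.
move: eb => /is_face_Cube[j lj ->]; subst l.
have i_n : i < n.+1 by case: j kl => /= j; lia.
pose k' := Ordinal i_n; have iE : i = widen_ord (leqnSn n.+1) k' by exact: val_inj.
exists (Cube (face (lift ord0 j) mu z)).
have -> : face j mu (face i nu z) = face k' nu (face (lift ord0 j) mu z).
  by rewrite faceC // -iE.
split; first exact: (IsFace nu k').
exact: (IsFace mu (lift ord0 j)).
Qed.

Lemma is_face_map (X Y : precubical) (f : pmor X Y) nu k (y x : cube X) :
  is_face nu k y x -> is_face nu k (cube_map f y) (cube_map f x).
Proof. by case=> n i z; rewrite /cube_map /= pmap_face; exact: IsFace. Qed.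

(** * Homotopy of cube paths under extension and under morphisms *)

Lemma cube_path_rcons (X : precubical) (s : seq (cube X)) a c :
  cube_path (rcons (rcons s a) c) = cube_path (rcons s a) && `[< step a c >].
Proof. by case: s => [|x s] /=; rewrite ?andbT // rcons_path last_rcons. Qed.

Lemma homotopic_ends (X : precubical) (s t : seq (cube X)) :
  homotopic s t ->
  [/\ cube_path s = cube_path t, ohead s = ohead t & forall c, last c s = last c t].
Proof.
elim=> [s1 t1 [-> -> [u [a [x [y [b [v [-> -> _ _]]]]]]]]|//|s1 s2 s3 _ [-> -> l1] _ [-> -> l2]].
  by split=> // [|c]; [case: u | rewrite !last_cat].
by split=> // c; rewrite l1.
Qed.

Lemma homotopic_pointed (X : hda) (s t : seq (cube X)) :
  homotopic s t -> pointed_path s -> pointed_path t.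
Proof. by move=> /homotopic_ends[e1 e2 _]; rewrite /pointed_path e1 e2. Qed.

Lemma homotopic_cube_path_rcons (X : precubical) (s t : seq (cube X)) c :
  homotopic s t -> cube_path (rcons s c) -> cube_path (rcons t c).
Proof.
move=> /homotopic_ends[]; case: s t => [|x s] [|y t] //= e1 [exy] /(_ c) /= e2.
by subst y; rewrite !rcons_path e2 e1.
Qed.

Lemma homotopic_rcons (X : precubical) (s t : seq (cube X)) c :
  homotopic s t -> cube_path (rcons s c) -> homotopic (rcons s c) (rcons t c).
Proof.
elim=> [s1 t1 h|s1|s1 s2 s3 h1 IH1 _ IH2] pc; last 2 first.
- exact: rt_refl.
- exact: rt_trans (IH1 pc) (IH2 (homotopic_cube_path_rcons h1 pc)).
have pc' := homotopic_cube_path_rcons (rt_step _ _ _ _ h) pc.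
case: h => _ _ [u [a [x [y [b [v [es et nxy sq]]]]]]].
apply: rt_step; split=> //.
exists u, a, x, y, b, (rcons v c); split=> //; first by rewrite es rcons_cat.
by rewrite et rcons_cat.
Qed.

Lemma homotopy_square_map (X Y : precubical) (f : pmor X Y) (a x y b : cube X) :
  homotopy_square a x y b ->
  homotopy_square (cube_map f a) (cube_map f x) (cube_map f y) (cube_map f b).
Proof.
move=> [k [l [kl h]]]; exists k, l; split=> //.
case: h => [[h1 h2 h3 h4]|[h1 h2 h3 h4]|[[z h1 h2] h3 h4]|[[z h1 h2] h3 h4]];
  [constructor 1|constructor 2|constructor 3|constructor 4];
  by split; try (exists (cube_map f z)); exact: is_face_map.
Qed.

Lemma cube_path_map (X Y : precubical) (f : pmor X Y) (s : seq (cube X)) :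
  cube_path s -> cube_path (map (cube_map f) s).
Proof.
case: s => [//|c t] /=; elim: t c => [//|d t IH] c /= /andP[/asboolP sd pt].
by apply/andP; split; [apply/asboolP; apply: step_map | apply: IH].
Qed.

(** Adjacency demands distinct middle cubes, but a square may degenerate, for instance under a
    morphism; reflexivity of homotopy covers that case. *)
Lemma homotopic_square (X : precubical) (u v : seq (cube X)) a x y b :
  cube_path (u ++ [:: a, x, b & v]) -> cube_path (u ++ [:: a, y, b & v]) ->
  homotopy_square a x y b \/ homotopy_square a y x b ->
  homotopic (u ++ [:: a, x, b & v]) (u ++ [:: a, y, b & v]).
Proof.
move=> ps pt sq; have [->|nxy] := EM (x = y); first exact: rt_refl.
by apply: rt_step; split=> //; exists u, a, x, y, b, v.
Qed.

Lemma homotopic_map (X Y : precubical) (f : pmor X Y) (s t : seq (cube X)) :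
  homotopic s t -> homotopic (map (cube_map f) s) (map (cube_map f) t).
Proof.
elim=> [s1 t1 [ps pt [u [a [x [y [b [v [es et _ sq]]]]]]]]|s1|s1 s2 s3 _ h1 _ h2].
- move: (cube_path_map f ps) (cube_path_map f pt).
  rewrite es et !map_cat /= => ps' pt'.
  apply: homotopic_square => //.
   by case: sq => /(homotopy_square_map f) h; [left | right].
- exact: rt_refl.
- exact: rt_trans h1 h2.
Qed.

(* If the path ends with [b], [c], then by induction it can be rearranged to end
   with [e], [b], [c], where the lower face [e] of [b] is chosen so that one
   homotopy square exchanges [b] for the [k]-th lower face [a] of [c]. *)
Lemma homotopic_last_lower (X : hda) (s : seq (cube X)) c k :
  pointed_path (rcons s c) -> k < projT1 c ->
  exists t a, is_face false k a c /\ homotopic (rcons s c) (rcons (rcons t a) c).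
Proof.
elim/last_ind: s c k => [|s b IH] c k.
  by case=> _ /= [->].
move=> [ps hs] kc; move: (ps); rewrite cube_path_rcons => /andP[pb /asboolP sbc].
have hb : pointed_path (rcons s b) by split=> //; move: hs; case: (s).
(* The induction hypothesis is applied to [b] with an index [j] chosen case by case, so that the
   [k]-th lower face [a] of [c] is one step away from the lower face [e] of [b]. *)
have exchange j : j < projT1 b ->
    (forall e, is_face false j e b -> exists a, [/\ is_face false k a c, step e a &
      homotopy_square e b a c \/ homotopy_square e a b c]) ->
    exists t a, is_face false k a c /\
      homotopic (rcons (rcons s b) c) (rcons (rcons t a) c).
  move=> jb ex; have [t [e [eb ht]]] := IH b j hb jb.
  have [a [ac ea sq]] := ex e eb.
  have hc := homotopic_rcons ht ps.
  exists (rcons t e), a; split=> //; apply: rt_trans hc _.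
  have [+ _ _] := homotopic_ends (homotopic_rcons ht ps); rewrite ps => /esym p1.
  have p2 : cube_path (rcons (rcons (rcons t e) a) c).
    rewrite !cube_path_rcons; move: p1; rewrite !cube_path_rcons => /andP[/andP[-> _] _].
    by apply/andP; split; apply/asboolP => //; exists k; left.
  by move: p1 p2; rewrite -!cats1 -!catA /= => p1 p2; apply: homotopic_square.
case: sbc => l [bc|cb].
- have [eqd lc] := is_face_dim bc.
  have [kl|lk|ekl] := ltngtP k l.
  + apply: (exchange k) => [|e eb]; first by lia.
    have [a [ea ac]] := is_face_swap kl eb bc.
    exists a; split=> //; first by exists l.-1; left.
    by left; exists k, l; split=> //; constructor 1.
  + apply: (exchange k.-1) => [|e eb]; first by lia.
    (* For [l < k], [d_l d_k = d_(k-1) d_l], which shifts the index on [b] to [k - 1]. *)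
    have lk' : l <= k.-1 by lia.
    have [a [ea ac]] := is_face_swapS lk' eb bc.
    rewrite prednK in ac; last by lia.
    exists a; split=> //; first by exists l; left.
    by right; exists l, k; split=> //; constructor 1.
  + by subst l; exists s, b; split=> //; exact: rt_refl.
(* Now [c] is an upper face of [b]: the way from [e] up to [b] and down to [c] is replaced by the
   way down to [a] and up to [c]. For [l <= k], [d_k d_l = d_l d_(k+1)] makes [k + 1] the index on
   [b]. *)
- have [eqd lb] := is_face_dim cb.
  have [a ac] := is_face_exists false kc.
  have [kl|lk] := ltnP k l.
  + apply: (exchange k) => [|e eb]; first by lia.
    have [e' [ae e'b]] := is_face_swap kl ac cb.
    have ee := is_face_fun e'b eb; subst e'.
    exists a; split=> //; first by exists l.-1; right.
    by right; exists k, l; split=> //; constructor 3; split=> //; exists c.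
  + apply: (exchange k.+1) => [|e eb]; first by lia.
    have [e' [ae e'b]] := is_face_swapS lk ac cb.
    have ee := is_face_fun e'b eb; subst e'.
    exists a; split=> //; first by exists l; right.
    by right; exists l, k.+1; split=> //; constructor 4; split=> //; exists e.
Qed.

(** * Faces in the unfolding *)

Lemma hclassP (X : hda) n (p q : ppath X n) :
  hclass p = hclass q <-> homotopic (ppseq p) (ppseq q).
Proof.
split=> [/eqmodP/asboolP //|h]; apply/eqmodP; exact/asboolP.
Qed.

Lemma hclass_repr (X : hda) n (p : ppath X n) :
  homotopic (ppseq (hrepr (hclass p))) (ppseq p).
Proof. by apply/hclassP; rewrite hreprK. Qed.

Lemma homotopic_ppend (X : hda) n (p q : ppath X n) :
  homotopic (ppseq p) (ppseq q) -> ppend p = ppend q.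
Proof.
move=> /homotopic_ends[_ _ /(_ (Cube (ppend p)))].
by rewrite /ppseq !last_rcons => /Cube_inj.
Qed.

Lemma unf_pi_hclass (X : hda) n (p : ppath X n) : unf_pi (hclass p) = ppend p.
Proof. exact/homotopic_ppend/hclass_repr. Qed.

Lemma unf_pi_point (X : hda) : unf_pi (unf_point X) = point X.
Proof. exact: unf_pi_hclass. Qed.

Lemma ppseq_path (X : hda) n (p : ppath X n) : pointed_path (ppseq p).
Proof. exact: ppathP. Qed.

Lemma unf_upper_hclass (X : hda) n (k : 'I_n.+1) (p : ppath X n.+1) :
  unf_upper k (hclass p) = hclass (PPath (upface_ppathP k p)).
Proof.
apply/hclassP; rewrite /ppseq /= -!/(ppseq _).
rewrite (homotopic_ppend (hclass_repr p)).
apply: homotopic_rcons (hclass_repr p) _.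
have := upface_ppathP k (hrepr (hclass p)).
by rewrite (homotopic_ppend (hclass_repr p)) => -[].
Qed.

(** A relation rather than a function, since a lower face may consist of several classes: [d] is
    then any one of them. *)
Definition unf_face (X : hda) n (k : 'I_n.+1) (nu : bool) (c : unf X n.+1)
    (d : unf X n) : Prop :=
  if nu then d = unf_upper k c else class_set d `<=` unf_lower k c.

(** One representative suffices, because the lower face is closed under homotopy. *)
Lemma unf_lower_hclass (X : hda) n (k : 'I_n.+1) (p : ppath X n.+1) (q : ppath X n) :
  unf_face k false (hclass p) (hclass q) <->
  ppend q = face k false (ppend p) /\
  homotopic (rcons (ppseq q) (Cube (ppend p))) (ppseq p).
Proof.
rewrite /unf_face /unf_lower unf_pi_hclass; split=> [/(_ q erefl)[qp h]|[qp h] r /hclassP rq].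
  by split=> //; apply: rt_trans h (hclass_repr p).
split; first by rewrite (homotopic_ppend rq).
have pq : cube_path (rcons (ppseq q) (Cube (ppend p))).
  by have [-> _ _] := homotopic_ends h; have [] := ppseq_path p.
apply: rt_trans (homotopic_sym (hclass_repr p)); apply: rt_trans h.
exact/homotopic_sym/homotopic_rcons/pq/homotopic_sym.
Qed.

Lemma unf_pi_face (X : hda) n (k : 'I_n.+1) nu (c : unf X n.+1) (d : unf X n) :
  unf_face k nu c d -> unf_pi d = face k nu (unf_pi c).
Proof.
case: nu => [->|]; first by rewrite /unf_upper unf_pi_hclass.
rewrite -(hreprK c) -(hreprK d) => /unf_lower_hclass[e _].
by rewrite !unf_pi_hclass.
Qed.

(** Appending the common end cube to any path in [d] yields a path in [c] and in [c']. *)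
Lemma unf_lower_inj (X : hda) n (k : 'I_n.+1) (c c' : unf X n.+1) (d : unf X n) :
  unf_face k false c d -> unf_face k false c' d -> unf_pi c = unf_pi c' -> c = c'.
Proof.
rewrite -(hreprK c) -(hreprK c') -(hreprK d) !unf_pi_hclass.
move=> /unf_lower_hclass[_ h] /unf_lower_hclass[_ h'] e.
by apply/hclassP; apply: rt_trans (homotopic_sym h) _; rewrite e.
Qed.

Lemma unf_face_exists (X : hda) n (k : 'I_n.+1) nu (c : unf X n.+1) :
  exists d, unf_face k nu c d.
Proof.
case: nu; first by exists (unf_upper k c).
rewrite -(hreprK c); set p := hrepr c; case: p => s x ps.
have [t [a [/is_face_Cube[i ki ea] h]]] :=
  homotopic_last_lower ps (ltn_ord k : k < projT1 (Cube x)).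
have {}ki : i = k by exact: val_inj.
rewrite {}ki {i} in ea; rewrite {}ea {a} in h.
have pt : pointed_path (rcons t (Cube (face k false x))).
  have := homotopic_pointed h ps; rewrite /pointed_path cube_path_rcons.
  by case=> /andP[-> _]; case: (t).
by exists (hclass (PPath pt)); apply/unf_lower_hclass; split=> //; apply: homotopic_sym.
Qed.

(** Induction along a representing cube path, whose last step either enters a cube from a lower face
    or leaves one to an upper face. *)
Lemma unf_ind (X : hda) (Pr : forall n, unf X n -> Prop) :
  Pr 0 (unf_point X) ->
  (forall n (k : 'I_n.+1) c d, unf_face k false c d -> Pr n d -> Pr n.+1 c) ->
  (forall n (k : 'I_n.+1) c, Pr n.+1 c -> Pr n (unf_upper k c)) ->
  forall n (c : unf X n), Pr n c.
Proof.
move=> H0 Hlow Hup n c; rewrite -(hreprK c); case: (hrepr c) => s x ps {c}.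
elim/last_ind: s n x ps => [|s b IH] n x ps.
  have e : Cube (point X) = Cube x by have [_ /= h] := ps; congruence.
  have en : 0 = n by move: (congr1 (@projT1 _ _) e).
  subst n; move/Cube_inj: e => e; subst x.
  by congr (Pr 0 (hclass _)): H0; congr PPath; exact: Prop_irrelevance.
have [+ hs] := ps; rewrite cube_path_rcons => /andP[pb /asboolP [k sbx]].
have qs : pointed_path (rcons s b) by split=> //; move: hs; case: (s).
case: sbx => /is_faceE[m [i [z [_ ex eb]]]].
  have en : n = m.+1 by move: (congr1 (@projT1 _ _) ex).
  subst n; move/Cube_inj: ex => ex; subst z b.
  apply: Hlow (IH _ _ qs).
  by apply/unf_lower_hclass; split=> //; exact: rt_refl.
have en : n = m by move: (congr1 (@projT1 _ _) eb).
subst n; move/Cube_inj: eb => eb; subst x b.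
move: (Hup _ i _ (IH _ _ qs)); rewrite unf_upper_hclass.
by congr (Pr m (hclass _)); congr PPath; exact: Prop_irrelevance.
Qed.

Lemma umap_face (X Y : hda) (f : unf_mor X Y) n (k : 'I_n.+1) nu c d :
  unf_face k nu c d -> unf_face k nu (f _ c) (f _ d).
Proof. by case: nu => [->|]; [exact: umap_upper | exact: umap_lower]. Qed.

(* By induction along a cube path: upper faces are preserved, and [unf_lower_inj]
   recovers a class from a lower face and its end cube. *)
Lemma unf_mor_ext (X Y : hda) (f g : unf_mor X Y) :
  (forall n (c : unf X n), unf_pi (f n c) = unf_pi (g n c)) ->
  forall n (c : unf X n), f n c = g n c.
Proof.
move=> fg; apply: unf_ind => [|n k c d cd e|n k c e].
- by rewrite !umap_point.
- have := umap_face f cd; rewrite e => h.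
  exact: unf_lower_inj h (umap_face g cd) (fg _ c).
- by rewrite !umap_upper e.
Qed.

(** * Functoriality of the unfolding *)

Lemma unf_map_hclass (X Y : hda) (g : hmor X Y) n (p : ppath X n) :
  unf_map g (hclass p) = hclass (ppath_map g p).
Proof.
have ppseq_map (q : ppath X n) : ppseq (ppath_map g q) = map (cube_map g) (ppseq q).
  by rewrite /ppseq map_rcons.
by apply/hclassP; rewrite !ppseq_map; apply/homotopic_map/hclass_repr.
Qed.

Lemma unf_pi_map (X Y : hda) (g : hmor X Y) n (c : unf X n) :
  unf_pi (unf_map g c) = g n (unf_pi c).
Proof. by rewrite /unf_map unf_pi_hclass. Qed.

Lemma unf_map_point (X Y : hda) (g : hmor X Y) :
  unf_map g (unf_point X) = unf_point Y.
Proof.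
rewrite unf_map_hclass; apply/hclassP.
by rewrite /ppseq /= hmap_point; exact: rt_refl.
Qed.

Lemma unf_map_face (X Y : hda) (g : hmor X Y) n (k : 'I_n.+1) nu c d :
  unf_face k nu c d -> unf_face k nu (unf_map g c) (unf_map g d).
Proof.
case: nu => [->|].
  rewrite -(hreprK c) unf_upper_hclass !unf_map_hclass /= unf_upper_hclass.
  apply/hclassP; rewrite /ppseq /= map_rcons pmap_face; exact: rt_refl.
rewrite -(hreprK c) -(hreprK d) => /unf_lower_hclass[e h].
rewrite !unf_map_hclass; apply/unf_lower_hclass; split; first by rewrite /= e pmap_face.
by have := homotopic_map g h; rewrite /ppseq !map_rcons.
Qed.

Definition unf_functor (X Y : hda) (g : hmor X Y) : unf_mor X Y :=
  @UnfMor X Y (@unf_map X Y g) (unf_map_point g)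
    (fun n k c => unf_map_face g (erefl : unf_face k true c (unf_upper k c)))
    (fun n k c d => @unf_map_face X Y g n k false c d).

Lemma unf_comp_point (X Y Z : hda) (g : unf_mor Y Z) (f : unf_mor X Y) :
  g 0 (f 0 (unf_point X)) = unf_point Z.
Proof. by rewrite !umap_point. Qed.

Lemma unf_comp_upper (X Y Z : hda) (g : unf_mor Y Z) (f : unf_mor X Y) n
    (k : 'I_n.+1) (c : unf X n.+1) :
  g n (f n (unf_upper k c)) = unf_upper k (g n.+1 (f n.+1 c)).
Proof. by rewrite !umap_upper. Qed.

Definition unf_comp (X Y Z : hda) (g : unf_mor Y Z) (f : unf_mor X Y) : unf_mor X Z :=
  @UnfMor X Z (fun n c => g n (f n c)) (unf_comp_point g f) (unf_comp_upper g f)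
    (fun n k c d cd => umap_lower (umap_lower cd)).

(** * Path objects are their own unfoldings *)

Section PathObject.
Variable P : path_object.

Definition po_class n (c : P n) : unf P n := projT1 (cid (po_tree c)).

Lemma po_classK n (c : P n) : unf_pi (po_class c) = c.
Proof. by rewrite /po_class; case: cid => u []. Qed.

Lemma po_class_pi n (u : unf P n) : po_class (unf_pi u) = u.
Proof.
have [v [_ uniq]] := po_tree (unf_pi u).
by rewrite -(uniq _ (po_classK _)) -(uniq u).
Qed.

(** Some face exists in the unfolding, and in a path object its end cube determines it; so faces are
    single-valued here. *)
Lemma po_class_face n (k : 'I_n.+1) nu (c : P n.+1) :
  unf_face k nu (po_class c) (po_class (face k nu c)).
Proof.
have [d cd] := unf_face_exists k nu (po_class c).
by have := unf_pi_face cd; rewrite po_classK => <-; rewrite po_class_pi.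
Qed.

Variables (X : hda) (p : unf_mor P X).

Lemma po_hmor_face n (k : 'I_n.+1) nu (c : P n.+1) :
  unf_pi (p n (po_class (face k nu c))) = face k nu (unf_pi (p n.+1 (po_class c))).
Proof. exact/unf_pi_face/umap_face/po_class_face. Qed.

Lemma po_class_point : po_class (point P) = unf_point P.
Proof. by rewrite -(po_class_pi (unf_point P)) unf_pi_point. Qed.

Lemma po_hmor_point : unf_pi (p 0 (po_class (point P))) = point X.
Proof. by rewrite po_class_point umap_point unf_pi_point. Qed.

(** Projecting to end cubes loses nothing, by [unf_mor_ext]. *)
Definition po_hmor : hmor P X :=
  @Hmor P X (@Pmor P X (fun n c => unf_pi (p n (po_class c))) po_hmor_face)
    po_hmor_point.

End PathObject.

(** * Unfolding open maps and labeled maps *)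

Lemma hdp_h_class (P Q : path_object) (h : unf_mor P Q) (g : hmor P Q) :
  (forall n (c : unf P n), unf_pi (h n c) = g n (unf_pi c)) ->
  forall n (c : P n), h n (po_class c) = po_class (g n c).
Proof. by move=> hg n c; rewrite -(po_class_pi (h n _)) hg po_classK. Qed.

(** The lifting problem is projected to end cubes, solved among automata, and the solution unfolded;
    [unf_mor_ext] reduces both triangles to end cubes. *)
Lemma unf_functor_open (X Y : hda) (f : hmor X Y) :
  hda_open f -> hdah_open (unf_functor f).
Proof.
move=> of_ P Q h p q [g hdp_g hg] comm.
have [|r [rg fr]] := of_ P Q g (po_hmor p) (po_hmor q) hdp_g.
  by move=> n c /=; rewrite -unf_pi_map -(hdp_h_class hg) -comm.
exists (unf_functor r); split=> n c.
  apply: (@unf_mor_ext P X (unf_comp (unf_functor r) h) p) => m {}c /=.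
  by rewrite unf_pi_map hg rg /= po_class_pi.
apply: (@unf_mor_ext Q Y (unf_comp (unf_functor f) (unf_functor r)) q) => m {}c /=.
by rewrite !unf_pi_map fr /= po_class_pi.
Qed.

Lemma unf_functor_lab (S : countType) (X Y : lhda S) (f : hmor X Y) :
  lab_mor f -> lab_unf_mor (unf_functor f).
Proof.
move=> lf n c.
apply: (@unf_mor_ext X (bang_hda S) (unf_comp (unf_functor (hlab Y)) (unf_functor f))
  (unf_functor (hlab X))) => m {}c /=.
by rewrite !unf_pi_map /= lf.
Qed.

(** * The cofree precubical set on a family with face relations *)

Section Cofree.
Variables (U : nat -> Type).
Variable rel : forall n, 'I_n.+1 -> bool -> U n.+1 -> U n -> Prop.

(* Two consecutive dimensions of the cofree precubical set, with the face maps
   between them. *)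
Record stage n := Stage {
  low_cell : Type;
  high_cell : Type;
  low_top : low_cell -> U n;
  high_top : high_cell -> U n.+1;
  stage_face : 'I_n.+1 -> bool -> high_cell -> low_cell }.

(** The first matching object: the end points of an edge have no faces that would have to agree. *)
Record edge := Edge {
  edge_top : U 1;
  edge_face : 'I_1 -> bool -> U 0;
  edge_rel : forall k nu, rel k nu edge_top (edge_face k nu) }.

(* The matching object of a stage: elements of [U] with compatible faces. *)
Record filler n (s : stage n) := Filler {
  filler_top : U n.+2;
  filler_face : 'I_n.+2 -> bool -> high_cell s;
  filler_rel : forall k nu, rel k nu filler_top (high_top (filler_face k nu));
  fillerC : forall (k l : 'I_n.+1) nu mu, k <= l ->
    stage_face k nu (filler_face (lift ord0 l) mu)
    = stage_face l mu (filler_face (widen_ord (leqnSn n.+1) k) nu) }.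

(** The high level of [tower m] is by definition the low level of [tower m.+1], so face maps compose
    without casts and the precubical identity is the field [fillerC]. *)
Fixpoint tower n : stage n :=
  if n is m.+1 then
    @Stage m.+1 _ _ (@high_top _ (tower m)) (@filler_top _ (tower m))
      (fun k nu w => filler_face w k nu)
  else @Stage 0 _ _ id edge_top (fun k nu e => edge_face e k nu).

Definition cofree_cell n : Type := low_cell (tower n).
Definition cofree_top n : cofree_cell n -> U n := @low_top _ (tower n).
Definition cofree_face n (k : 'I_n.+1) nu : cofree_cell n.+1 -> cofree_cell n :=
  @stage_face _ (tower n) k nu.

Lemma cofree_faceC n (k l : 'I_n.+1) nu mu (w : cofree_cell n.+2) : k <= l ->
  cofree_face k nu (cofree_face (lift ord0 l) mu w)
  = cofree_face l mu (cofree_face (widen_ord (leqnSn n.+1) k) nu w).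
Proof. exact: fillerC. Qed.

Definition cofree : precubical := Precubical cofree_faceC.

Lemma cofree_rel n (k : 'I_n.+1) nu (w : cofree n.+1) :
  rel k nu (cofree_top w) (cofree_top (face k nu w)).
Proof. by case: n k w => [|n] k w; [exact: edge_rel | exact: filler_rel]. Qed.

Lemma cofree_ext n (w w' : cofree n.+1) :
  cofree_top w = cofree_top w' ->
  (forall k nu, face k nu w = face k nu w') -> w = w'.
Proof.
case: n w w' => [|n] [t f r] => [|c] [t' f' r'] => [|c'].
all: rewrite /cofree_top /= => et ef; subst t'.
all: have ef' : f = f' by apply/funext => k; apply/funext => nu; exact: ef.
all: subst f'.
  by congr Edge; exact: Prop_irrelevance.
by congr Filler; exact: Prop_irrelevance.
Qed.

(** * The universal property of the cofree precubical set *)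

Section Lift.
Variables (Q : precubical) (phi : forall n, Q n -> U n).
Hypothesis phi_rel : forall n (k : 'I_n.+1) nu (x : Q n.+1),
  rel k nu (phi x) (phi (face k nu x)).

(** The invariant for lifting [phi] up the tower: the next filler needs the lifts of its faces,
    their tops, and the commutation of [lift_high] with faces. *)
Record stage_lift n (s : stage n) := StageLift {
  lift_low : Q n -> low_cell s;
  lift_high : Q n.+1 -> high_cell s;
  lift_low_top : forall x, low_top (lift_low x) = phi x;
  lift_high_top : forall x, high_top (lift_high x) = phi x;
  lift_face : forall k nu x,
    stage_face k nu (lift_high x) = lift_low (face k nu x) }.

Definition edge_lift (x : Q 1) : edge :=
  Edge (fun k nu => phi_rel k nu x).

Lemma filler_lift_rel n (s : stage n) (t : stage_lift s) (x : Q n.+2) k nu :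
  rel k nu (phi x) (high_top (lift_high t (face k nu x))).
Proof. by rewrite lift_high_top. Qed.

(** The coherence of the chosen faces is inherited from [faceC] in [Q]. *)
Lemma filler_liftC n (s : stage n) (t : stage_lift s) (x : Q n.+2)
    (k l : 'I_n.+1) nu mu : k <= l ->
  stage_face k nu (lift_high t (face (lift ord0 l) mu x))
  = stage_face l mu (lift_high t (face (widen_ord (leqnSn n.+1) k) nu x)).
Proof. by move=> kl; rewrite !lift_face faceC. Qed.

Definition filler_lift n (s : stage n) (t : stage_lift s) (x : Q n.+2) : filler s :=
  Filler (@filler_lift_rel n s t x) (@filler_liftC n s t x).

Fixpoint tower_lift n : stage_lift (tower n) :=
  if n is m.+1 then
    @StageLift m.+1 (tower m.+1) (lift_high (tower_lift m))
      (filler_lift (tower_lift m)) (lift_high_top (tower_lift m))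
      (fun x => erefl) (fun k nu x => erefl)
  else
    @StageLift 0 (tower 0) (@phi 0) edge_lift (fun x => erefl) (fun x => erefl)
      (fun k nu x => erefl).

Definition cofree_lift_map n : Q n -> cofree n := lift_low (tower_lift n).

Lemma cofree_lift_face n (k : 'I_n.+1) nu (x : Q n.+1) :
  cofree_lift_map (face k nu x) = face k nu (cofree_lift_map x).
Proof. exact/esym/(lift_face (tower_lift n)). Qed.

Definition cofree_lift : pmor Q cofree := Pmor cofree_lift_face.

Lemma cofree_lift_top n (x : Q n) : cofree_top (cofree_lift n x) = phi x.
Proof. exact: lift_low_top. Qed.

End Lift.

(** Uniqueness of lifts, by induction on the dimension: a cell is its top with its faces, and in
    dimension 0 it is its top. *)
Lemma cofree_mor_ext (Q : precubical) (f g : pmor Q cofree) :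
  (forall n (x : Q n), cofree_top (f n x) = cofree_top (g n x)) ->
  forall n (x : Q n), f n x = g n x.
Proof.
move=> fg; elim=> [|n IH] x; first exact: (fg 0 x).
by apply: cofree_ext => [|k nu]; rewrite ?fg // -!pmap_face IH.
Qed.

End Cofree.

(** * The cofree precubical set on an unfolding *)

Definition unf_cofree (Z : hda) : hda :=
  @Hda (cofree (@unf_face Z)) (unf_point Z).

Definition unf_top (Z : hda) n (w : unf_cofree Z n) : unf Z n := cofree_top w.

Lemma unf_top_face (Z : hda) n (k : 'I_n.+1) nu (w : unf_cofree Z n.+1) :
  unf_face k nu (unf_top w) (unf_top (face k nu w)).
Proof. exact: cofree_rel. Qed.

Section CofreeMap.
Variables (Z X : hda) (f : unf_mor Z X).

Lemma cofree_map_face n (k : 'I_n.+1) nu (w : unf_cofree Z n.+1) :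
  unf_pi (f n (unf_top (face k nu w))) = face k nu (unf_pi (f n.+1 (unf_top w))).
Proof. exact/unf_pi_face/umap_face/unf_top_face. Qed.

Lemma cofree_map_point : unf_pi (f 0 (unf_top (point (unf_cofree Z)))) = point X.
Proof. by rewrite [unf_top _]/(unf_point Z) umap_point unf_pi_point. Qed.

Definition cofree_map : hmor (unf_cofree Z) X :=
  @Hmor (unf_cofree Z) X
    (@Pmor (unf_cofree Z) X (fun n w => unf_pi (f n (unf_top w))) cofree_map_face)
    cofree_map_point.

End CofreeMap.

(** * Morphisms from a path object into the cofree precubical set *)

Section PathCofree.
Variables (P : path_object) (Z : hda).

Definition po_unf_map (p : hmor P (unf_cofree Z)) n (c : unf P n) : unf Z n :=
  unf_top (p n (unf_pi c)).

Lemma po_unf_map_face (p : hmor P (unf_cofree Z)) n (k : 'I_n.+1) nu c d :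
  unf_face k nu c d -> unf_face k nu (po_unf_map p c) (po_unf_map p d).
Proof. by rewrite /po_unf_map => /unf_pi_face ->; rewrite pmap_face; exact: unf_top_face. Qed.

Lemma po_unf_map_point (p : hmor P (unf_cofree Z)) :
  po_unf_map p (unf_point P) = unf_point Z.
Proof. by rewrite /po_unf_map unf_pi_point hmap_point. Qed.

Definition po_unf_mor (p : hmor P (unf_cofree Z)) : unf_mor P Z :=
  @UnfMor P Z (po_unf_map p) (po_unf_map_point p)
    (fun n k c => po_unf_map_face p (erefl : unf_face k true c (unf_upper k c)))
    (fun n k c d => @po_unf_map_face p n k false c d).

Variable r : unf_mor P Z.

Lemma po_class_rel n (k : 'I_n.+1) nu (c : P n.+1) :
  unf_face k nu (r n.+1 (po_class c)) (r n (po_class (face k nu c))).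
Proof. exact/umap_face/po_class_face. Qed.

(** Transporting [r] along [po_class] selects a single class for each face, which is the coherent
    choice that a lift needs. *)
Definition po_cofree_pmor : pmor P (unf_cofree Z) :=
  @cofree_lift _ _ P (fun n c => r n (po_class c)) po_class_rel.

Lemma po_cofree_point :
  po_cofree_pmor 0 (point P) = point (unf_cofree Z).
Proof. by rewrite /= /cofree_lift_map /= po_class_point umap_point. Qed.

Definition po_cofree : hmor P (unf_cofree Z) :=
  @Hmor P (unf_cofree Z) po_cofree_pmor po_cofree_point.

Lemma unf_top_po_cofree n (c : P n) : unf_top (po_cofree n c) = r n (po_class c).
Proof. exact: cofree_lift_top. Qed.

End PathCofree.

Lemma cofree_map_open (Z X : hda) (f : unf_mor Z X) :
  hdah_open f -> hda_open (cofree_map f).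
Proof.
move=> of_ P Q g p q hdp_g comm.
have hg n (c : unf P n) : unf_pi (unf_functor g n c) = g n (unf_pi c).
  exact: unf_pi_map.
have [||r [rg fr]] := of_ P Q (unf_functor g) (po_unf_mor p) (unf_functor q).
- by exists g.
- move=> n c; apply: (@unf_mor_ext P X (unf_comp f (po_unf_mor p))
    (unf_comp (unf_functor q) (unf_functor g))) => m {}c /=.
  by rewrite !unf_pi_map -comm.
exists (po_cofree r); split=> n c.
  (* Both sides map into the cofree precubical set, so it is enough to compare tops, which are
     classes in the unfolding of [Z]. *)
  apply: (@cofree_mor_ext _ _ P (hcomp (po_cofree r) g) p) => m {}c.
  rewrite -[cofree_top _]/(unf_top (po_cofree r m (g m c))) unf_top_po_cofree.
  by rewrite -(hdp_h_class hg) rg /= /po_unf_map po_classK.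
by rewrite [LHS]/= unf_top_po_cofree fr /= unf_pi_map po_classK.
Qed.

(** The hypothesis equates classes in the unfolding of [bang S]; only their end cubes, the labels,
    are retained. *)
Lemma cofree_map_lab (S : countType) (Z X : lhda S) (f : unf_mor Z X) n
    (w : unf_cofree Z n) :
  lab_unf_mor f -> lab X n (cofree_map f n w) = lab Z n (unf_pi (unf_top w)).
Proof.
by move=> /(_ n (unf_top w)) /(congr1 (@unf_pi _ n)); rewrite !unf_pi_map.
Qed.

Lemma unf_pi_top_face (Z : hda) n (k : 'I_n.+1) nu (w : unf_cofree Z n.+1) :
  unf_pi (unf_top (face k nu w)) = face k nu (unf_pi (unf_top w)).
Proof. exact/unf_pi_face/unf_top_face. Qed.

Lemma unf_cofree_lab_face (S : countType) (Z : lhda S) n (k : 'I_n.+1) nu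
    (w : unf_cofree Z n.+1) :
  lab Z n (unf_pi (unf_top (face k nu w)))
  = face k nu (lab Z n.+1 (unf_pi (unf_top w))).
Proof. by rewrite unf_pi_top_face pmap_face. Qed.

Definition unf_cofree_lhda (S : countType) (Z : lhda S) : lhda S :=
  LHda (@Pmor (unf_cofree Z) (bang S) (fun n w => lab Z n (unf_pi (unf_top w)))
    (@unf_cofree_lab_face S Z)).

Theorem theorem7p8 (Sigma : countType) (X Y : lhda Sigma) :
  homotopy_bisimilar X Y <-> hd_bisimilar X Y.
Proof.
split=> [[Z [f [g [lf of_ lg og]]]]|[Z [f [g [lf of_ lg og]]]]].
  exists (unf_cofree_lhda Z), (cofree_map f), (cofree_map g); split.
  - by move=> n w; rewrite (cofree_map_lab _ lf).
  - exact: cofree_map_open.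
  - by move=> n w; rewrite (cofree_map_lab _ lg).
  - exact: cofree_map_open.
exists Z, (unf_functor f), (unf_functor g); split.
- exact: unf_functor_lab.
- exact: unf_functor_open.
- exact: unf_functor_lab.
- exact: unf_functor_open.
Qed.
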